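(* Let $\beta=2$ and let $u=u(x,t)$ be a smooth positive solution, for $x\in\mathbb{T}^d$, $t>0$, of the thin-film equation $$\partial_t u=-\operatorname{div}\big(u^\beta\nabla\Delta u\big)\quad\text{in }\mathbb{T}^d .$$ Let $S_0(t)=\int_{\mathbb{T}^d}(-\log u(x,t))\,dx$. Then $dS_0/dt\le 0$ for all $t>0$.
   Context: $\mathbb{T}^d=(\mathbb{R}/\mathbb{Z})^d$ is the $d$-dimensional torus. *)

(* Defs.v *)
From HB Require Import structures.
From mathcomp Require Import all_boot all_order all_algebra.
From mathcomp Require Import all_classical all_reals all_analysis.

Set Implicit Arguments.
Unset Strict Implicit.
Unset Printing Implicit Defensive.

Import Order.TTheory GRing.Theory Num.Theory.
Import numFieldNormedType.Exports.

Local Open Scope ring_scope.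
Local Open Scope classical_set_scope.

(* A function on the torus (R/Z)^d is represented by a function on R^d that is
   1-periodic in each coordinate; integrals over the torus are taken over the
   fundamental domain [0,1]^d. *)

Section spatial_operators.
Context {R : realType} {d : nat}.

Definition periodic (g : 'rV[R]_d -> R) :=
  forall x (i : 'I_d), g (x + delta_mx 0 i) = g x.

Definition grad (g : 'rV[R]_d -> R) (x : 'rV[R]_d) : 'rV[R]_d :=
  \row_i 'D_(delta_mx 0 i) g x.

Definition div (F : 'rV[R]_d -> 'rV[R]_d) (x : 'rV[R]_d) : R :=
  \sum_(i < d) 'D_(delta_mx 0 i) (fun y => F y 0 i) x.

Definition laplacian (g : 'rV[R]_d -> R) : 'rV[R]_d -> R := div (grad g).

End spatial_operators.

Section smoothness.
Context {R : realType} {d : nat}.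
Implicit Types (f : 'rV[R]_d * R -> R) (A : set ('rV[R]_d * R)).

(* [Some i] is the i-th space direction, [None] the time direction. *)
Definition coord_dir (k : option 'I_d) : 'rV[R]_d * R :=
  if k is Some i then (delta_mx 0 i, 0) else (0, 1).

Definition iter_partial (s : seq (option 'I_d)) f : 'rV[R]_d * R -> R :=
  foldr (fun k g => 'D_(coord_dir k) g) f s.

(* C^infinity on A, meant for A open: all mixed space-time partial derivatives
   of all orders exist at, and are (jointly) continuous at, every point of A. *)
Definition smooth_on A f :=
  forall (s : seq (option 'I_d)) z, A z ->
    {for z, continuous (iter_partial s f)} /\
    forall k, derivable (iter_partial s f) z (coord_dir k).

End smoothness.

Section torus_measure.
Context {R : realType}.

Definition unit_lebesgue : set (measurableTypeR R) -> \bar R :=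
  mrestr (@lebesgue_measure R) (measurable_itv `[0, 1]%R).

HB.instance Definition _ := Measure.on unit_lebesgue.

Let unit_lebesgue_setT : unit_lebesgue setT = 1%E.
Proof.
by rewrite /unit_lebesgue /mrestr setTI lebesgue_measure_itv/= lte01 oppr0 adde0.
Qed.

HB.instance Definition _ :=
  Measure_isProbability.Build _ _ _ unit_lebesgue unit_lebesgue_setT.

Definition tuple_cons (n : nat)
    (p : measurableTypeR R * n.-tuple (measurableTypeR R)) :
  n.+1.-tuple (measurableTypeR R) := [tuple of p.1 :: p.2].

Let measurable_tuple_cons n : measurable_fun setT (@tuple_cons n).
Proof. exact: measurable_cons. Qed.

HB.instance Definition _ n :=
  isMeasurableFun.Build _ _ _ _ (@tuple_cons n) (@measurable_tuple_cons n).

(* Lebesgue measure on [0,1]^d, as a d-fold product; [distribution P X] is the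
   image measure of P by X. *)
Fixpoint torus_measure (n : nat) :
    probability (n.-tuple (measurableTypeR R)) R :=
  if n is m.+1 then
    distribution (unit_lebesgue \x torus_measure m)%E (@tuple_cons m)
  else \d_([tuple]).

Definition torus_integral (d : nat) (g : 'rV[R]_d -> R) : R :=
  \int[torus_measure d]_x g (\row_i tnth x i).

End torus_measure.

Section thin_film.
Context {R : realType} {d : nat}.
Implicit Types (u : 'rV[R]_d -> R -> R).

Definition thin_film_equation (beta : R) u :=
  forall x t, 0 < t ->
    (u x)^`() t =
    - div (fun y => u y t `^ beta *: grad (laplacian (u ^~ t)) y) x.

(* smooth positive solutions on T^d x (0, +oo) *)
Definition smooth_positive_solution (beta : R) u :=
  [/\ forall t, 0 < t -> periodic (u ^~ t),
      smooth_on [set z | 0 < z.2] (fun z => u z.1 z.2),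
      forall x t, 0 < t -> 0 < u x t
    & thin_film_equation beta u].

Definition entropy0 u (t : R) : R := torus_integral (fun x => - ln (u x t)).

End thin_film.

(* Main.v *)
Require Import Defs.
From mathcomp Require Import all_boot all_order all_algebra.
From mathcomp Require Import all_classical all_reals all_analysis.
From mathcomp Require Import measurable_realfun ring lra.
Import numFieldNormedType.Exports.
Import Order.TTheory GRing.Theory Num.Theory.

(** With L = Delta u, a solution satisfies pointwise
      - (d/dt u) / u = div (u^2 grad L) / u = div (u grad L + L grad u) - L^2,
    an identity that only uses the product rule.  The left-hand side is the time
    derivative of - log u, so differentiating under the integral sign and
    integrating the divergence over the torus to zero leaves
      dS_0/dt = - \int (Delta u)^2 <= 0. *)

Local Open Scope ring_scope.
Local Open Scope classical_set_scope.

(** * Continuous periodic functions: measurability, boundedness, integrability *)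

(** The uniform structure on row vectors is entrywise, and finitely many conditions that each hold
    near [z] hold near [z] together. *)
Lemma continuous_row {R : realType} {T : topologicalType} {n : nat}
    (F : T -> 'rV[R]_n) :
  (forall i, continuous (fun z => F z 0 i)) -> continuous F.
Proof.
move=> cF z; apply/cvg_mx_entourageP => A entA.
have cFA : \forall y \near z, forall i, (F z 0 i, F y 0 i) \in A.
  apply: filter_forall => i.
  have /cvg_entourageP/(_ _ entA) cFi := cF i z.
  by near=> y; rewrite inE; near: y; exact: cFi.
by near=> y => i j; rewrite ord1; move: j; near: y; exact: cFA.
Unshelve. all: by end_near. Qed.

(* An open set is a countable union of rational balls, whose preimages are
   measurable boxes; this links the Borel sets of R^n to the product
   sigma-algebra on tuples. *)
Lemma measurable_continuous_row {R : realType} {n : nat} {g : 'rV[R]_n -> R} :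
  continuous g ->
  measurable_fun [set: n.-tuple (measurableTypeR R)]
    (fun x => g (\row_i tnth x i)).
Proof.
move=> cg; apply: (measurability _ (RGenOpens.measurableE R)).
move=> _ [_ [a [b ->] <-]]; rewrite setTI.
set W := (X in measurable X).
(* [F (q, k)] is the open cube with rational centre [q] and half-side [1/(k+1)]; the index type is
   countable. *)
pose F (qk : 'rV[rat]_n * nat) : set (n.-tuple (measurableTypeR R)) :=
  [set x | forall i, ball (ratr (qk.1 0 i) : R) qk.2.+1%:R^-1 (tnth x i)].
have mF qk : measurable (F qk).
  rewrite [F _](_ : _ = \bigcap_(i : 'I_n) ((@tnth _ _)^~ i) @^-1`
      (ball (ratr (qk.1 0 i) : R) qk.2.+1%:R^-1)); last first.
    by apply/seteqP; split=> x /= Fx i; [move=> _; exact: Fx|exact: Fx].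
  apply: fin_bigcap_measurable => // i _; rewrite -[X in measurable X]setTI.
  by apply: measurable_tnth => //; exact: measurable_ball.
pose D := [set qk | F qk `<=` W].
(* Cubes not contained in [W] are replaced by the empty set, so that the union runs over the whole
   countable type. *)
rewrite [W](_ : _ = \bigcup_qk (if qk \in D then F qk else set0)).
  apply: countable_bigcupT_measurable => // qk.
  by case: ifP.
apply/seteqP; split => [x Wx|x [qk _]]; last first.
  by case: ifPn => // /set_mem; exact.
have /nbhs_ballP[e /= e0 eO] :
    nbhs (\row_i tnth x i : 'rV[R]_n) (g @^-1` `]a, b[%classic).
  by apply: cg; apply: open_nbhs_nbhs; split => //; exact: interval_open.
(* A half-side below [e / 2] puts any two points of one cube within [e] of each other in every
   coordinate. A cube containing [x] therefore lies in [W]. *)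
have [k _ /(_ k (leqnn _)) ke] := near_infty_natSinv_lt (PosNum (divr_gt0 e0 (ltr0n _ 2))).
have k0 : (0 : R) < k.+1%:R^-1 by rewrite invr_gt0.
have /choice[q xq] i : exists q : rat, ball (ratr q : R) k.+1%:R^-1 (tnth x i).
  have /rat_in_itvoo[q] : tnth x i < tnth x i + k.+1%:R^-1 by rewrite ltrDl.
  rewrite in_itv/= => /andP[xq qx]; exists q.
  by rewrite -ball_normE/= gtr0_norm ?subr_gt0// ltrBlDl.
exists (\row_i q i, k) => //.
have xF : F (\row_i q i, k) x by move=> i /=; rewrite mxE.
rewrite mem_set// => y Fy.
apply: eO; split => // i j; rewrite !mxE /=.
have /= := Fy j; rewrite mxE => yj.
have sub z : ball (ratr (q j) : R) k.+1%:R^-1 z -> ball (ratr (q j) : R) (e / 2) z.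
  by apply: le_ball; exact: ltW.
exact: ball_splitr (sub _ (xq j)) (sub _ yj).
Qed.

Lemma periodic_bounded {R : realType} {d : nat} (H : 'rV[R]_d * R -> R) (a b : R) :
  a <= b ->
  (forall z, a <= z.2 <= b -> {for z, continuous H}) ->
  (forall t, a <= t <= b -> Defs.periodic (fun x => H (x, t))) ->
  exists M, forall x t, a <= t <= b -> `|H (x, t)| <= M.
Proof.
move=> ab cH pH.
(* By periodicity it suffices to bound H on [0,1]^d x [a, b]. *)
pose K : set ('rV[R]_d * R) :=
  [set v : 'rV[R]_d | forall i, `[0, 1]%classic (v ord0 i)] `*` `[a, b]%classic.
have cK : compact K.
  apply: compact_setX; last exact: segment_compact.
  apply: (@rV_compact R d (fun=> `[0, 1]%classic)) => i; exact: segment_compact.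
have K0 : K !=set0.
  exists (0, a); split => /=; last by rewrite in_itv/= lexx.
  by move=> i; rewrite mxE in_itv/= lexx ler01.
have cHK : {within K, continuous (fun z => `|H z|)}.
  apply: continuous_in_subspaceT => z /set_mem[_ /=]; rewrite in_itv/= => zab.
  by apply: cvg_norm; exact: cH.
have [c _ Hc] := compact_EVT_max K0 cK cHK.
exists `|H c| => x t tab.
have shift1 y i m : H (y + delta_mx 0 i *+ m, t) = H (y, t).
  elim: m => [|m IH]; first by rewrite mulr0n addr0.
  by rewrite mulrSr addrA (pH t tab) IH.
have shiftz y i (m : int) : H (y + m%:~R *: delta_mx 0 i, t) = H (y, t).
  case: m => m; first by rewrite -pmulrn scaler_nat shift1.
  rewrite NegzE mulrNz scaleNr -pmulrn scaler_nat.
  by rewrite -(shift1 _ i m.+1) subrK.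
have shifts (s : seq 'I_d) (m : 'I_d -> int) y :
    H (y + \sum_(i <- s) (m i)%:~R *: delta_mx 0 i, t) = H (y, t).
  elim: s y => [|i s IH] y; first by rewrite big_nil addr0.
  by rewrite big_cons addrA IH shiftz.
(* Subtracting the integer part of each coordinate moves [x] into the unit cube without changing
   [H]. *)
pose y : 'rV[R]_d := x + \sum_i (- Num.floor (x 0 i))%:~R *: delta_mx 0 i.
rewrite -(shifts (index_enum _) (fun i => - Num.floor (x 0 i))) -/y.
apply: Hc; apply/mem_set; split => /=; last by rewrite in_itv.
move=> i; rewrite in_itv/= !mxE summxE (bigD1 i)//= big1 => [|j ji].
  rewrite !mxE !eqxx mulr1 addr0 mulrNz subr_ge0 floor_le andTb lerBlDl.
  by rewrite -(intrD _ _ 1); exact/ltW/floorD1_gt.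
by rewrite !mxE [i == j]eq_sym (negPf ji) andbF mulr0.
Qed.

Lemma periodic_bounded_space {R : realType} {d : nat} {g : 'rV[R]_d -> R} :
  continuous g -> Defs.periodic g -> exists M, forall x, `|g x| <= M.
Proof.
move=> cg pg.
(* The spatial case is read off from a function constant in time, over the degenerate time interval
   [[0, 0]]. *)
have [||t _|M gM] := @periodic_bounded R d (fun z => g z.1) 0 0.
- exact: lexx.
- by move=> z _; apply: continuous_comp; [exact: cvg_fst|exact: cg].
- exact: pg.
- by exists M => x; apply: (gM x 0); rewrite lexx.
Qed.

Lemma integrable_torus {R : realType} {d : nat} {g : 'rV[R]_d -> R} :
  continuous g -> Defs.periodic g ->
  (torus_measure d).-integrable setT
    (fun x : d.-tuple (measurableTypeR R) => (g (\row_i tnth x i))%:E).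
Proof.
move=> cg pg; apply: measurable_bounded_integrable => //.
- by rewrite ltey_eq fin_num_measure.
- exact: measurable_continuous_row.
- have [M gM] := periodic_bounded_space cg pg.
  exists M; split; first exact: num_real.
  by move=> N MN x _; apply: le_trans (gM _) (ltW MN).
Qed.

(** * Vanishing of the torus integral of a partial derivative *)

(** Counterpart of [tuple_cons] for row vectors, used to pass between the recursive product measure
    and functions on ['rV[R]_n.+1]. *)
Definition row_cons {R : realType} {n : nat} (s : R) (y : 'rV[R]_n) : 'rV[R]_n.+1 :=
  \row_i oapp (y 0) s (unlift ord0 i).

Lemma row_cons0 {R : realType} {n : nat} (s : R) (y : 'rV[R]_n) : row_cons s y 0 ord0 = s.
Proof. by rewrite mxE unlift_none. Qed.

Lemma row_consS {R : realType} {n : nat} (s : R) (y : 'rV[R]_n) (j : 'I_n) :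
  row_cons s y 0 (lift ord0 j) = y 0 j.
Proof. by rewrite mxE liftK. Qed.

Lemma row_cons_tuple {R : realType} {n : nat} (s : R) (x : n.-tuple R) :
  \row_i tnth [tuple of s :: x] i = row_cons s (\row_i tnth x i).
Proof.
apply/rowP => i; case: (unliftP ord0 i) => [j|] ->.
  by rewrite row_consS !mxE tnthS.
by rewrite row_cons0 mxE tnth0.
Qed.

(** This identity and the next one turn difference quotients along a basis vector into difference
    quotients of a slice, with either the tail or the head held fixed. *)
Lemma row_cons_head {R : realType} {n : nat} (s h : R) (y : 'rV[R]_n) :
  row_cons (h + s) y = h *: delta_mx 0 ord0 + row_cons s y.
Proof.
apply/rowP => i; rewrite !mxE; case: (unliftP ord0 i) => [j|] ->.
  by rewrite /= mulr0 add0r.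
by rewrite /= mulr1.
Qed.

Lemma row_cons_tail {R : realType} {n : nat} (s h : R) (j : 'I_n) (y : 'rV[R]_n) :
  row_cons s (h *: delta_mx 0 j + y) = h *: delta_mx 0 (lift ord0 j) + row_cons s y.
Proof.
apply/rowP => i; rewrite !mxE; case: (unliftP ord0 i) => [k|] ->.
  by rewrite /= !mxE (inj_eq lift_inj).
by rewrite /= mulr0 add0r.
Qed.

Lemma continuous_row_cons_tail {R : realType} {n : nat} (s : R) :
  continuous (@row_cons R n s).
Proof.
apply: continuous_row => i; case: (unliftP ord0 i) => [j|] ->.
  under eq_fun do rewrite row_consS.
  exact: coord_continuous.
under eq_fun do rewrite row_cons0.
exact: cst_continuous.
Qed.

Lemma continuous_row_cons_head {R : realType} {n : nat} (y : 'rV[R]_n) :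
  continuous (fun s => row_cons s y).
Proof.
apply: continuous_row => i; case: (unliftP ord0 i) => [j|] ->.
  under eq_fun do rewrite row_consS.
  exact: cst_continuous.
under eq_fun do rewrite row_cons0.
by move=> s; exact: cvg_id.
Qed.

(** [unit_lebesgue] lives on the whole line but gives the complement of [[0, 1]] mass zero, and it
    agrees with Lebesgue measure inside. The right-hand side is the form required by the fundamental
    theorem of calculus. *)
Lemma integral_unit_lebesgue {R : realType} (f : R -> \bar R) :
  (@unit_lebesgue R).-integrable setT f ->
  (\int[unit_lebesgue]_x f x = \int[lebesgue_measure]_(x in `[0%R, 1%R]) f x)%E.
Proof.
move=> fi.
rewrite (negligible_integral
  (N := ~` (`[0%R, 1%R]%classic : set (measurableTypeR R))))//.
- rewrite setTD setCK; apply: eq_measure_integral => A mA A01.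
  by rewrite /= /unit_lebesgue /mrestr setIidl.
- exact: measurableC.
- by rewrite /= /unit_lebesgue /mrestr setICl measure0.
Qed.

(** The difference quotients at [x] and at its translate are the same function of the increment,
    hence so are their limits. *)
Lemma periodic_partial {R : realType} {n : nat} {g : 'rV[R]_n -> R} (v : 'rV[R]_n) :
  Defs.periodic g -> Defs.periodic ('D_v g).
Proof.
move=> pg x j; rewrite /derive.
by under eq_fun do rewrite /= addrA !pg.
Qed.

Lemma integral_torusS {R : realType} {n : nat}
    (f : n.+1.-tuple (measurableTypeR R) -> \bar R) :
  measurable_fun setT f ->
  (@unit_lebesgue R \x torus_measure n)%E.-integrable setT (f \o @tuple_cons R n) ->
  (\int[torus_measure n.+1]_x f x =
   \int[@unit_lebesgue R \x torus_measure n]_p f (tuple_cons p))%E.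
Proof. by move=> mf intf; exact: (integral_distribution mf intf). Qed.

(* Induction on the dimension: peel off the first coordinate by Fubini; if it is
   the direction of differentiation, conclude by the fundamental theorem of
   calculus and periodicity, otherwise by induction on the slices. *)
Lemma torus_integral_partial {R : realType} (n : nat) (i : 'I_n) (g : 'rV[R]_n -> R) :
  Defs.periodic g -> (forall x, derivable g x (delta_mx 0 i)) ->
  continuous ('D_(delta_mx 0 i) g) ->
  torus_integral ('D_(delta_mx 0 i) g) = 0.
Proof.
elim: n i g => [[]//|n IH] i g pg dg cDg.
set h := 'D_(delta_mx 0 i) g.
have ph : Defs.periodic h by exact: periodic_partial.
have mh := measurable_continuous_row cDg.
rewrite /torus_integral /Rintegral.
suff -> : (\int[torus_measure n.+1]_x (h (\row_i tnth x i))%:E = 0)%E by [].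
pose hc (p : measurableTypeR R * n.-tuple (measurableTypeR R)) :=
  h (row_cons p.1 (\row_i tnth p.2 i)).
have mhc : measurable_fun setT hc.
  rewrite [X in measurable_fun _ X](_ : _ =
    (fun x => h (\row_i tnth x i)) \o @tuple_cons R n); last first.
    by apply/funext => p; rewrite /hc /= -row_cons_tuple.
  exact: measurableT_comp mh (measurable_cons measurable_fst measurable_snd).
have ihc : (@unit_lebesgue R \x torus_measure n)%E.-integrable setT (EFin \o hc).
  have [M hM] := periodic_bounded_space cDg ph.
  apply: measurable_bounded_integrable => //.
  - exact: le_lt_trans (@probability_le1 _ _ _
      (@unit_lebesgue R \x torus_measure n)%E setT measurableT) (ltry 1).
  - exists M; split; first exact: num_real.
    by move=> N MN x _; apply: le_trans (hM _) (ltW MN).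
have -> : (\int[torus_measure n.+1]_x (h (\row_i tnth x i))%:E =
    \int[@unit_lebesgue R \x torus_measure n]_p (EFin \o hc) p)%E.
  rewrite integral_torusS.
  - by apply: eq_integral => p _; rewrite /hc /= -row_cons_tuple.
  - exact/measurable_EFinP.
  - apply: eq_integrable ihc => // p _; by rewrite /hc /= -row_cons_tuple.
case: (unliftP ord0 i) => [j|] iE.
  (* Differentiation along a tail direction: with the head [s] fixed, the inner integral over the
     tail is that of a partial derivative in dimension [n]. *)
  rewrite -integral12_prod_meas1//; apply: integral0_eq => s _.
  rewrite /fubini_F /=.
  have DE (y : 'rV[R]_n) r :
      row_cons s (r *: delta_mx 0 j + y) = r *: delta_mx 0 i + row_cons s y.
    by rewrite iE row_cons_tail.
  pose gs (y : 'rV[R]_n) := g (row_cons s y).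
  have Dgs : 'D_(delta_mx 0 j) gs = fun y => h (row_cons s y).
    apply/funext => y; rewrite /h /gs /derive.
    by under eq_fun do rewrite /= DE.
  have pgs : Defs.periodic gs.
    move=> y k; rewrite /gs -[delta_mx 0 k]scale1r addrC row_cons_tail.
    by rewrite scale1r addrC pg.
  have chs : continuous (fun y => h (row_cons s y)).
    by move=> y; exact: continuous_comp (continuous_row_cons_tail s y) (cDg _).
  have phs : Defs.periodic (fun y => h (row_cons s y)).
    by rewrite -Dgs; exact: periodic_partial.
  have dgs y : derivable gs y (delta_mx 0 j).
    rewrite /derivable /gs; under eq_fun do rewrite /= DE.
    exact: dg.
  have int0 : torus_integral (fun y => h (row_cons s y)) = 0.
    by have := IH j gs pgs dgs; rewrite Dgs => /(_ chs).
  (* The induction hypothesis concerns the real-valued integral; integrability makes the extended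
     one finite, so it vanishes as well. *)
  apply/eqP; rewrite -fine_eq0; first exact/eqP.
  exact: integrable_fin_num (integrable_torus chs phs).
(* Differentiation along the head: with the tail fixed, the inner integral is that of [G'] over
   [[0, 1]]. *)
rewrite -integral21_prod_meas1//; apply: integral0_eq => x _.
rewrite /fubini_G /=.
set y := \row_k tnth x k.
have DE s r : row_cons (r + s) y = r *: delta_mx 0 i + row_cons s y.
  by rewrite iE row_cons_head.
pose G s := g (row_cons s y).
have DG : G^`() = fun s => h (row_cons s y).
  apply/funext => s; rewrite derive1E /h /derive.
  by under eq_fun do rewrite /= /G scaler1 DE.
have dG s : derivable G s 1.
  rewrite /derivable /G; under eq_fun do rewrite /= scaler1 DE.
  exact: dg.
have cG : continuous G.
  by move=> s; apply/differentiable_continuous; rewrite -derivable1_diffP.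
have cDG : continuous (fun s => h (row_cons s y)).
  by move=> s; exact: continuous_comp (continuous_row_cons_head y s) (cDg _).
rewrite integral_unit_lebesgue.
  rewrite (@continuous_FTC2 _ _ G 0 1 ltr01).
  (* [G 1 = G 0], since the two arguments of [g] differ by the first basis vector. *)
  - by rewrite /G -[1]addr0 row_cons_head scale1r [_ + row_cons 0 y]addrC pg subee.
  - exact: continuous_subspaceT.
  - split; first by move=> s _; exact: dG.
    + by apply: cvg_at_right_filter; exact: cG.
    + by apply: cvg_at_left_filter; exact: cG.
  - by move=> s _; rewrite DG.
have [M hM] := periodic_bounded_space cDg ph.
apply: measurable_bounded_integrable => //.
- exact: le_lt_trans (@probability_le1 _ _ _ (@unit_lebesgue R) setT measurableT) (ltry 1).
- exact: continuous_measurable_fun.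
- exists M; split; first exact: num_real.
  by move=> N MN s _; apply: le_trans (hM _) (ltW MN).
Qed.

(** * Functions of class C^1 and the pointwise divergence identity *)

(** Phrased with partial derivatives along the basis vectors, the form in which
    [torus_integral_partial] takes its hypotheses. *)
Definition C1 {R : realType} {d : nat} (g : 'rV[R]_d -> R) :=
  continuous g /\ forall i : 'I_d,
    (forall x, derivable g x (delta_mx 0 i)) /\ continuous ('D_(delta_mx 0 i) g).

Lemma C1D {R : realType} {d : nat} (f g : 'rV[R]_d -> R) :
  C1 f -> C1 g -> C1 (fun x => f x + g x).
Proof.
move=> [cf f1] [cg g1]; split=> [x|i]; first exact: continuousD (cf x) (cg x).
have [[df cDf] [dg cDg]] := (f1 i, g1 i).
split=> [x|]; first exact: derivableD.
rewrite [X in continuous X](_ : _ = 'D_(delta_mx 0 i) f + 'D_(delta_mx 0 i) g).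
  by move=> x; exact: continuousD (cDf x) (cDg x).
by apply/funext => x; rewrite deriveD.
Qed.

Lemma C1M {R : realType} {d : nat} (f g : 'rV[R]_d -> R) :
  C1 f -> C1 g -> C1 (fun x => f x * g x).
Proof.
move=> [cf f1] [cg g1]; split=> [x|i]; first exact: continuousM (cf x) (cg x).
have [[df cDf] [dg cDg]] := (f1 i, g1 i).
split=> [x|]; first exact: derivableM.
rewrite [X in continuous X](_ : _ =
    (fun x => f x * 'D_(delta_mx 0 i) g x + g x * 'D_(delta_mx 0 i) f x)).
  move=> x; exact: continuousD (continuousM (cf x) (cDg x))
    (continuousM (cg x) (cDf x)).
by apply/funext => x; rewrite deriveM.
Qed.

Lemma C1_sum {R : realType} {d n : nat} (f : 'I_n -> 'rV[R]_d -> R) :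
  (forall j, C1 (f j)) -> C1 (fun x => \sum_j f j x).
Proof.
move=> f1; rewrite -fct_sumE.
apply: (big_ind (@C1 R d)) => //; last by move=> g h; exact: C1D.
split=> [|i]; first exact: cst_continuous.
split=> [x|]; first exact: derivable_cst.
rewrite (_ : 'D_ _ _ = cst 0); first exact: cst_continuous.
by apply/funext => x; exact: derive_cst.
Qed.

Lemma laplacianE {R : realType} {d : nat} (g : 'rV[R]_d -> R) (x : 'rV[R]_d) :
  laplacian g x = \sum_i 'D_(delta_mx 0 i) ('D_(delta_mx 0 i) g) x.
Proof.
rewrite /laplacian /div; apply: eq_bigr => i _.
rewrite [X in derive X](_ : _ = 'D_(delta_mx 0 i) g)//.
by apply/funext => y; rewrite mxE.
Qed.

(** In each direction both sides expand to [f^2 L'' + 2 f f' L']: the term [L f''] of the divergence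
    on the right is cancelled by [L * laplacian f]. *)
Lemma div_thin_film {R : realType} {d : nat} (f L : 'rV[R]_d -> R) :
  (forall x, 0 < f x) -> C1 f -> C1 L ->
  (forall i, C1 ('D_(delta_mx 0 i) f)) -> (forall i, C1 ('D_(delta_mx 0 i) L)) ->
  forall x, div (fun y => f y `^ 2 *: grad L y) x =
    f x * (div (fun y => f y *: grad L y + L y *: grad f y) x - L x * laplacian f x).
Proof.
move=> f0 [_ f1] [_ L1] f2 L2 x; rewrite laplacianE /div mulr_sumr -sumrB mulr_sumr.
apply: eq_bigr => i _.
have [[df _] [dL _]] := (f1 i, L1 i).
have [_ /(_ i)[d2f _]] := f2 i; have [_ /(_ i)[d2L _]] := L2 i.
set e := delta_mx 0 i.
have -> : (fun y => (f y `^ 2 *: grad L y) 0 i) = f * f * 'D_e L.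
  (* Positivity of [f] turns the real power into an ordinary square. *)
  by apply/funext => y; rewrite !mxE powR_mulrn ?ltW.
have -> : (fun y => (f y *: grad L y + L y *: grad f y) 0 i) = f * 'D_e L + L * 'D_e f.
  by apply/funext => y; rewrite !mxE.
have -> : 'D_e (f * f * 'D_e L) x = f x * f x * 'D_e ('D_e L) x +
    'D_e L x * (f x * 'D_e f x + f x * 'D_e f x).
  rewrite (deriveM (derivableM (df x) (df x)) (d2L x)) (deriveM (df x) (df x)).
  exact: erefl.
have -> : 'D_e (f * 'D_e L + L * 'D_e f) x =
    f x * 'D_e ('D_e L) x + 'D_e L x * 'D_e f x +
    (L x * 'D_e ('D_e f) x + 'D_e f x * 'D_e L x).
  rewrite (deriveD (derivableM (df x) (d2L x)) (derivableM (dL x) (d2f x))).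
  rewrite (deriveM (df x) (d2L x)) (deriveM (dL x) (d2f x)).
  exact: erefl.
move: (f x) (L x) ('D_e f x) ('D_e L x) ('D_e ('D_e f) x) ('D_e ('D_e L) x).
move=> *; ring.
Qed.

(** * The divergence theorem on the torus *)

Lemma continuous_periodic_sum {R : realType} {d n : nat} (h : 'I_n -> 'rV[R]_d -> R)
    (s : seq 'I_n) :
  (forall i, continuous (h i)) -> (forall i, Defs.periodic (h i)) ->
  continuous (fun x => \sum_(i <- s) h i x) /\
  Defs.periodic (fun x => \sum_(i <- s) h i x).
Proof.
move=> ch ph; split=> [|x j]; last by apply: eq_bigr => i _; rewrite ph.
by apply: continuous_big => // p; exact: add_continuous.
Qed.

Lemma torus_integral_sum {R : realType} {d n : nat} (h : 'I_n -> 'rV[R]_d -> R) :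
  (forall i, continuous (h i)) -> (forall i, Defs.periodic (h i)) ->
  torus_integral (fun x => \sum_i h i x) = \sum_i torus_integral (h i).
Proof.
move=> ch ph; elim: (index_enum _) => [|i s IH].
  rewrite big_nil /torus_integral; under eq_Rintegral do rewrite big_nil.
  by rewrite /Rintegral integral0.
rewrite big_cons -IH /torus_integral; under eq_Rintegral do rewrite big_cons.
have [cs ps] := continuous_periodic_sum h s ch ph.
by rewrite RintegralD//; [exact: integrable_torus (ch i) (ph i)|exact: integrable_torus cs ps].
Qed.

Lemma torus_integral_div {R : realType} {d : nat} (F : 'rV[R]_d -> 'rV[R]_d) :
  (forall i, C1 (fun y => F y 0 i)) -> (forall i, Defs.periodic (fun y => F y 0 i)) ->
  [/\ continuous (div F), Defs.periodic (div F) & torus_integral (div F) = 0].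
Proof.
move=> F1 pF.
pose h i := 'D_(delta_mx 0 i) (fun y => F y 0 i).
have ch i : continuous (h i) by have [_ /(_ i)[]] := F1 i.
have ph i : Defs.periodic (h i) by exact: periodic_partial.
have [cs ps] := continuous_periodic_sum h (index_enum _) ch ph.
split => //; rewrite -[LHS]/(torus_integral (fun x => \sum_i h i x)).
rewrite torus_integral_sum// big1// => i _.
by apply: torus_integral_partial => //; have [_ /(_ i)[]] := F1 i.
Qed.

(** * Slices of space-time functions at a fixed time or a fixed point *)

Lemma shift_section {R : realType} {d : nat} (v : 'rV[R]_d) (h : R) (y : 'rV[R]_d) (t : R) :
  h *: (v, 0) + (y, t) = (h *: v + y, t) :> 'rV[R]_d * R.
Proof. by rewrite -[LHS]/(h *: v + y, h *: 0 + t) scaler0 add0r. Qed.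

Lemma derive_section {R : realType} {d : nat} (f : 'rV[R]_d * R -> R) (v : 'rV[R]_d) (t : R) :
  'D_v (fun y => f (y, t)) = fun y => 'D_(v, 0) f (y, t).
Proof.
apply/funext => y; rewrite /derive.
by under [in RHS]eq_fun do rewrite /= shift_section.
Qed.

Lemma derive_iter_partial {R : realType} {d : nat} (f : 'rV[R]_d * R -> R)
    (s : seq (option 'I_d)) (i : 'I_d) (t : R) :
  'D_(delta_mx 0 i) (fun y => iter_partial s f (y, t)) =
  fun y => iter_partial (Some i :: s) f (y, t).
Proof. exact: derive_section. Qed.

Lemma derivable_section {R : realType} {d : nat} (f : 'rV[R]_d * R -> R) (v y : 'rV[R]_d) (t : R) :
  derivable f (y, t) (v, 0) -> derivable (fun y => f (y, t)) y v.
Proof. by rewrite /derivable; under eq_fun do rewrite /= shift_section. Qed.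

Lemma shift_time {R : realType} {d : nat} (h : R) (y : 'rV[R]_d) (t : R) :
  h *: (0, 1) + (y, t) = (y, h *: 1 + t) :> 'rV[R]_d * R.
Proof. by rewrite -[LHS]/(h *: 0 + y, h *: 1 + t) scaler0 add0r. Qed.

Lemma derive_time {R : realType} {d : nat} (f : 'rV[R]_d * R -> R) (y : 'rV[R]_d) (t : R) :
  (fun s => f (y, s))^`() t = 'D_(0, 1) f (y, t).
Proof.
rewrite derive1E /derive.
by under [in RHS]eq_fun do rewrite /= shift_time.
Qed.

Lemma derivable_time {R : realType} {d : nat} (f : 'rV[R]_d * R -> R) (y : 'rV[R]_d) (t : R) :
  derivable f (y, t) (0, 1) -> derivable (fun s => f (y, s)) t 1.
Proof. by rewrite /derivable; under eq_fun do rewrite /= shift_time. Qed.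

Lemma continuous_pair_time {R : realType} {d : nat} (y : 'rV[R]_d) (t : R) :
  {for y, continuous (fun y => (y, t))}.
Proof.
have Fy : ProperFilter (nbhs y) by exact: nbhs_pfilter.
by apply: (@cvg_pair _ _ _ _ (nbhs y) (nbhs t)); [exact: cvg_id|exact: cvg_cst].
Qed.

(** A spatial derivative of a slice is the slice of the iterated partial with one more direction,
    whose continuity [smooth_on] also provides. *)
Lemma smooth_section_C1 {R : realType} {d : nat} (f : 'rV[R]_d * R -> R)
    (s : seq (option 'I_d)) (t : R) :
  smooth_on [set z | 0 < z.2] f -> 0 < t -> C1 (fun y => iter_partial s f (y, t)).
Proof.
move=> sf t0; have cf s' (y : 'rV[R]_d) :
    {for y, continuous (fun y => iter_partial s' f (y, t))}.
  have [+ _] := sf s' (y, t) t0; apply: continuous_comp.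
  exact: continuous_pair_time.
split=> [|i]; first exact: cf.
split=> [y|]; last by rewrite derive_section; exact: (cf (Some i :: s)).
by have [_ /(_ (Some i))/derivable_section] := sf s (y, t) t0.
Qed.

(** * Entropy dissipation along a solution *)

Section entropy.
Context {R : realType} {d : nat} (u : 'rV[R]_d -> R -> R)
  (hu : smooth_positive_solution 2 u).
Let U (z : 'rV[R]_d * R) := u z.1 z.2.
(** The time derivative of [- ln u], written as a function on space-time so that its joint
    continuity is available for uniform bounds. *)
Let w (z : 'rV[R]_d * R) := - ((U z)^-1 * iter_partial [:: None] U z).

Let sU : smooth_on [set z | 0 < z.2] U. Proof. by case: hu. Qed.
Let U0 (x : 'rV[R]_d) (t : R) : 0 < t -> 0 < U (x, t).
Proof. by case: hu => _ _ + _; apply. Qed.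
Let pU (t : R) : 0 < t -> Defs.periodic (fun x => U (x, t)).
Proof. by case: hu => + _ _ _; apply. Qed.

Let cw (z : 'rV[R]_d * R) : 0 < z.2 -> {for z, continuous w}.
Proof.
case: z => x t t0; have [cU _] := sU [::] (x, t) t0.
have [cUt _] := sU [:: None] (x, t) t0.
apply: continuousN; apply: continuousM => //.
by apply: continuousV => //=; rewrite gt_eqF// U0.
Qed.

Let pw (t : R) : 0 < t -> Defs.periodic (fun x => w (x, t)).
Proof.
move=> t0 x i; rewrite /w pU// -[iter_partial _ _ _]derive_time.
rewrite -[iter_partial _ _ (x, t)]derive_time; congr (- (_ * _)).
(* Periodicity is known only at positive times, which suffices because the time derivative depends
   only on times near [t]. *)
rewrite !derive1E; apply: near_eq_derive; near=> s; apply: pU.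
by near: s; exact: lt_nbhsr.
Unshelve. all: by end_near. Qed.

Let is_derive_log (x : 'rV[R]_d) (t : R) : 0 < t ->
  is_derive t 1 (fun s => - ln (u x s)) (w (x, t)).
Proof.
move=> t0; have [_ /(_ None)/derivable_time dU] := sU [::] (x, t) t0.
have ux : is_derive t 1 (u x) (iter_partial [:: None] U (x, t)).
  by rewrite -[iter_partial _ _ _]derive_time derive1E; exact: derivableP.
have lnu : is_derive (u x t) 1 (@ln R) (u x t)^-1.
  by apply: is_derive1_ln; exact: U0.
exact: is_deriveN (is_derive1_comp lnu ux).
Qed.

Let periodic_iter (t : R) (s : seq 'I_d) : 0 < t ->
  Defs.periodic (fun x => iter_partial (map Some s) U (x, t)).
Proof.
move=> t0; elim: s => [|i s IH]; first exact: pU.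
rewrite [X in Defs.periodic X](_ : _ =
    'D_(delta_mx 0 i) (fun x => iter_partial (map Some s) U (x, t))).
  exact: periodic_partial.
by rewrite derive_section.
Qed.

Let laplacian_iter (t : R) : laplacian (u ^~ t) =
  fun x => \sum_(j < d) iter_partial [:: Some j; Some j] U (x, t).
Proof.
apply/funext => x; rewrite laplacianE; apply: eq_bigr => j _.
rewrite (derive_iter_partial U [::]).
exact: (congr1 (@^~ x) (derive_iter_partial U [:: Some j] j t)).
Qed.

Let grad_laplacian_iter (t : R) (i : 'I_d) : 0 < t ->
  'D_(delta_mx 0 i) (laplacian (u ^~ t)) =
  fun x => \sum_(j < d) iter_partial [:: Some i; Some j; Some j] U (x, t).
Proof.
move=> t0; apply/funext => x; rewrite laplacian_iter -fct_sumE derive_sum.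
  apply: eq_bigr => j _.
  exact: (congr1 (@^~ x) (derive_iter_partial U [:: Some j; Some j] i t)).
move=> j; have [_ /(_ i)[+ _]] := smooth_section_C1 U [:: Some j; Some j] t sU t0.
exact.
Qed.

(** The field is [F = u grad L + L grad u] with [L] the Laplacian of [u]. The equation replaces the
    time derivative in [w] by a divergence, and [div_thin_film] then cancels the factor [1/u]. *)
Let entropy_production (t : R) : 0 < t ->
  exists F : 'rV[R]_d -> 'rV[R]_d,
  [/\ forall i, C1 (fun y => F y 0 i), forall i, Defs.periodic (fun y => F y 0 i) &
      forall x, w (x, t) = div F x - laplacian (u ^~ t) x ^+ 2].
Proof.
move=> t0; set f := u ^~ t; set L := laplacian f.
have f1 : C1 f by exact: (smooth_section_C1 U [::] t).
have fi1 i : C1 ('D_(delta_mx 0 i) f).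
  by rewrite (derive_iter_partial U [::]); exact: (smooth_section_C1 U [:: Some i] t).
have L1 : C1 L.
  rewrite /L laplacian_iter; apply: C1_sum => j.
  exact: (smooth_section_C1 U [:: Some j; Some j] t sU t0).
have Li1 i : C1 ('D_(delta_mx 0 i) L).
  rewrite /L (grad_laplacian_iter t i t0); apply: C1_sum => j.
  exact: (smooth_section_C1 U [:: Some i; Some j; Some j] t sU t0).
have pf : Defs.periodic f by exact: pU.
have pL : Defs.periodic L.
  move=> x i; rewrite /L laplacian_iter; apply: eq_bigr => j _.
  exact: (periodic_iter t [:: j; j] t0).
have FE i : (fun y => (f y *: grad L y + L y *: grad f y) 0 i) =
    (fun y => f y * 'D_(delta_mx 0 i) L y + L y * 'D_(delta_mx 0 i) f y).
  by apply/funext => y; rewrite !mxE.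
exists (fun y => f y *: grad L y + L y *: grad f y); split.
- by move=> i; rewrite FE; apply: C1D; apply: C1M.
- move=> i; rewrite FE => x j.
  by rewrite pf pL (periodic_partial _ pf) (periodic_partial _ pL).
move=> x; have f0 y : 0 < f y by exact: U0.
have pde : derive1 (u x) t = - div (fun y => f y `^ 2 *: grad L y) x.
  by have [_ _ _] := hu; exact.
have -> : w (x, t) = - ((f x)^-1 * derive1 (u x) t).
  by rewrite (derive_time U x t).
rewrite pde (div_thin_film f L f0 f1 L1 fi1 Li1) mulrN opprK mulKf//.
by rewrite gt_eqF.
Qed.

Lemma entropy_dissipation (t : R) : 0 < t ->
  derivable (entropy0 u) t 1 /\ (entropy0 u)^`() t <= 0.
Proof.
move=> t0.
pose f (s : R) (y : d.-tuple (measurableTypeR R)) := - ln (u (\row_i tnth y i) s).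
(* An open interval around [t] whose closure is compact and stays in positive times, so that one
   constant bounds [w] over all of it. *)
pose I : set R := `]t / 2, t * 2[%classic.
have It : I t by rewrite /I /= in_itv/=; lra.
have I0 s : I s -> 0 < s by rewrite /I/= in_itv/= => /andP[+ _]; lra.
have dfE s y : I s -> partial1of2 f s y = w (\row_i tnth y i, s).
  move=> /I0 s0; rewrite partial1of2E; have := is_derive_log (\row_i tnth y i) s s0.
  by move=> /@derive_val.
have intf s : I s -> (torus_measure d).-integrable setT (EFin \o f s).
  move=> /I0 s0; have [cu _] := smooth_section_C1 U [::] s sU s0.
  have clnu : continuous (fun x => - ln (u x s)).
    move=> x; apply: (@continuousN _ _ _ (fun x => ln (u x s))).
    exact: continuous_comp (cu x) (continuous_ln (U0 x s s0)).
  apply: (integrable_torus clnu) => x i; congr (- ln _); exact: (pU s s0).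
have derf s y : I s -> setT y -> derivable (f^~ y) s 1.
  by move=> /I0 s0 _; have [] := is_derive_log (\row_i tnth y i) s s0.
have [M wM] : exists M, forall x s, t / 2 <= s <= t * 2 -> `|w (x, s)| <= M.
  apply: periodic_bounded; first lra.
  - by move=> z /andP[z0 _]; apply: cw; lra.
  - by move=> s /andP[s0 _]; apply: pw; lra.
have M0 : 0 <= M by apply: le_trans (wM 0 t _) => //; lra.
have dfM s y : I s -> setT y -> `|partial1of2 f s y| <= cst M y.
  move=> Is _; rewrite dfE//; apply: wM.
  by move: Is; rewrite /I/= in_itv/= => /andP[]; lra.
have intM : (torus_measure d).-integrable setT
    (EFin \o (cst M : d.-tuple (measurableTypeR R) -> R)).
  exact: (@integrable_torus _ _ (cst M) (@cst_continuous _ _ _)).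
split.
  exact: (derivable_under_integral measurableT It intf derf (fun=> M0) intM dfM).
rewrite [leLHS](differentiation_under_integral measurableT It intf derf (fun=> M0) intM dfM).
have [F [F1 pF wE]] := entropy_production t t0.
have [cdF pdF intF] := torus_integral_div F F1 pF.
(* Writing [0] as the integral of [div F] reduces the claim to the pointwise bound [w <= div F],
   where the gap is the squared Laplacian. *)
rewrite -intF /torus_integral; apply: le_Rintegral => //.
- rewrite [X in _.-integrable _ X](_ : _ = fun y => (w (\row_i tnth y i, t))%:E).
    apply: (@integrable_torus _ _ (fun x => w (x, t))); last exact: pw.
    by move=> x; apply: continuous_comp; [exact: continuous_pair_time|exact: cw].
  by apply/funext => y; rewrite /= dfE.
- exact: (integrable_torus cdF pdF).
- by move=> y _; rewrite dfE// wE lerBlDr lerDl sqr_ge0.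
Qed.

End entropy.

Theorem proposition10 (R : realType) (d : nat) (hd : (0 < d)%N)
  (beta : R) (hbeta : beta = 2) (u : 'rV[R]_d -> R -> R)
  (hu : smooth_positive_solution beta u) :
  forall t : R, 0 < t ->
    derivable (entropy0 u) t 1 /\ (entropy0 u)^`() t <= 0.
Proof.
by move=> t; rewrite hbeta in hu; exact: entropy_dissipation hu t.
Qed.
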